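(* Let $\mathbf K=\big(k(x_i,x_j)\big)_{i,j=1}^{n}$ denote the Gram matrix associated with the scalar-valued kernel $k$, and let $$K_{n,m}=\big(k(x_i,\tilde x_j)\big)_{i,j=1}^{n,m},\qquad K_{m,m}=\big(k(\tilde x_i,\tilde x_j)\big)_{i,j=1}^{m}.$$ Let $\mathbf y=(y_1,\dots,y_n)$ and define the norm $\|\cdot\|_n$ by $$\|\mathbf y\|_n^2=\frac1n\sum_{i=1}^n\|y_i\|_{\mathcal Y}^2 .$$ Then the estimator $\widehat f_{m,\lambda}$ minimizing $$\frac1n\sum_{i=1}^n\|y_i-f(x_i)\|_{\mathcal Y}^2+\lambda\|f\|_{\mathcal G}^2$$ over $f\in\operatorname{span}\{k_{\tilde x_1},\dots,k_{\tilde x_m}\}$ admits the representation $$\widehat f_{m,\lambda}(x)=\sum_{j=1}^m\tilde b_j\,k_{\tilde x_j}(x),\qquad \mathbf b=(\tilde b_1,\tilde b_2,\dots,\tilde b_m)=\left(K_{n,m}^\top K_{n,m}+\lambda\,K_{m,m}\right)^{-1}K_{n,m}^\top\mathbf y .$$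
   Context: $\mathcal X$ is a second countable locally compact Hausdorff space, $\mathcal Y$ is a real separable Hilbert space, and $(x_1,y_1),\dots,(x_n,y_n)\in\mathcal X\times\mathcal Y$ are the training data. $\lambda>0$ is the regularization parameter. $k:\mathcal X\times\mathcal X\to\mathbb R$ is a scalar-valued reproducing kernel, $k_x=k(x,\cdot)$, and $\mathcal G$ is the vector-valued reproducing kernel Hilbert space of functions $\mathcal X\to\mathcal Y$ associated with the operator-valued kernel $K(x,t)=k(x,t)\,Id_{\mathcal Y}$, where $Id_{\mathcal Y}$ is the identity operator on $\mathcal Y$; that is, $\mathcal G$ is the completion of the span of the functions $K_xy=k(\cdot,x)y$ ($x\in\mathcal X$, $y\in\mathcal Y$) under the inner product $\langle K_xy,K_{x'}y'\rangle_{\mathcal G}=k(x,x')\langle y,y'\rangle_{\mathcal Y}$. The points $\tilde x_1,\dots,\tilde x_m$ are sampled uniformly from the training inputs $\{x_1,\dots,x_n\}$. The span is understood with $\mathcal Y$-valued coefficients: its elements are the functions $\sum_{j=1}^m\tilde b_j\,k(\tilde x_j,\cdot)$ with $\tilde b_j\in\mathcal Y$. A real $p\times q$ matrix $A$ acts on $\mathbf v\in\mathcal Y^q$ by $(A\mathbf v)_i=\sum_jA_{ij}v_j\in\mathcal Y$.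
   Formalization: The printed formula is off by a factor n for n ≥ 2; here the transpose of K_{n,m} is replaced by (1/n) times it, so b = (K_{n,m}^T K_{n,m} + nλ K_{m,m})^{-1} K_{n,m}^T y, stated when this matrix is invertible. *)

(* Defs.v *)
From HB Require Import structures.
From mathcomp Require Import all_boot all_order all_algebra.
From mathcomp Require Import all_classical all_reals all_analysis.
Set Implicit Arguments.
Unset Strict Implicit.
Unset Printing Implicit Defensive.
Import Order.TTheory GRing.Theory Num.Theory.
Import numFieldNormedType.Exports.
Local Open Scope classical_set_scope.
Local Open Scope ring_scope.

(* Real Hilbert spaces: a complete normed space whose norm comes from a
   symmetric positive definite bilinear form. *)
Record hilbertType (R : realType) := Hilbert {
  hcarrier :> completeNormedModType R;
  hdot : {dot hcarrier for idfun};
  hdotvv : forall u : hcarrier, hdot u u = `|u| ^+ 2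
}.

Definition separable (T : topologicalType) : Prop :=
  exists2 D : set T, countable D & dense D.

(* Scalar reproducing kernels, i.e. symmetric kernels all of whose Gram
   matrices are positive semidefinite; strict definiteness is not required. *)
Definition reproducing_kernel (R : realType) (X : Type) (k : X -> X -> R) :
  Prop :=
  (forall x t, k x t = k t x) /\
  (forall (p : nat) (x : 'I_p -> X) (c : 'I_p -> R),
      0 <= \sum_(i < p) \sum_(j < p) c i * c j * k (x i) (x j)).

(* The vector-valued RKHS of the kernel K(x,t) = k(x,t) Id_Y. It is a Hilbert
   space containing the span of the K_x y isometrically and densely, i.e. the
   completion of that span; [rkev] realizes its elements as functions X -> Y
   and [rksec x y] is K_x y. These data are unique up to isometry. *)
Record vvRKHS (R : realType) (X : Type) (Y : hilbertType R) (k : X -> X -> R) :=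
  VVRKHS {
  rkhs :> hilbertType R;
  rkev : rkhs -> X -> Y;
  rksec : X -> Y -> rkhs;
  rkev_linear : forall (a : R) (f g : rkhs) (x : X),
    rkev (a *: f + g) x = a *: rkev f x + rkev g x;
  rkev_inj : forall f g : rkhs, (forall x, rkev f x = rkev g x) -> f = g;
  rkev_sec : forall (x t : X) (y : Y), rkev (rksec x y) t = k t x *: y;
  rkdot_sec : forall (x x' : X) (y y' : Y),
    hdot rkhs (rksec x y) (rksec x' y') = k x x' * hdot Y y y';
  rk_reproducing : forall (f : rkhs) (x : X) (y : Y),
    hdot rkhs f (rksec x y) = hdot Y (rkev f x) y;
  rk_dense : dense [set f : rkhs | exists (p : nat) (x : 'I_p -> X)
    (c : 'I_p -> Y), f = \sum_(i < p) rksec (x i) (c i)]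
}.

Section Nystrom.
Variables (R : realType) (X : Type) (Y : hilbertType R) (k : X -> X -> R).

Definition gram p q (u : 'I_p -> X) (v : 'I_q -> X) : 'M[R]_(p, q) :=
  \matrix_(i, j) k (u i) (v j).

(* Action of a real p x q matrix on Y^q. *)
Definition mxact p q (A : 'M[R]_(p, q)) (v : 'I_q -> Y) : 'I_p -> Y :=
  fun i => \sum_(j < q) A i j *: v j.

(* The inner product of the norm || . ||_n on Y^n. *)
Definition dotn n (u v : 'I_n -> Y) : R :=
  n%:R^-1 * \sum_(i < n) hdot Y (u i) (v i).

Definition normn n (v : 'I_n -> Y) : R := Num.sqrt (dotn v v).

(* The transpose of a sampling matrix A : Y^m -> (Y^n, || . ||_n) is its
   adjoint for || . ||_n on Y^n and the unweighted norm on Y^m. As a matrix it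
   is A^T / n (see [dotn_adjn]); with the bare A^T the formula
   (A^T A + lam K)^-1 A^T y would not minimize a risk averaged with weight
   1/n unless n = 1. *)
Definition adjn n m (A : 'M[R]_(n, m)) : 'M[R]_(m, n) := n%:R^-1 *: A^T.

Definition nystrom_span m (G : vvRKHS Y k) (xt : 'I_m -> X) : set G :=
  [set f | exists b : 'I_m -> Y,
     forall t, rkev f t = \sum_(j < m) k (xt j) t *: b j].

Definition reg_risk n (G : vvRKHS Y k) (x : 'I_n -> X) (y : 'I_n -> Y)
    (lam : R) (f : G) : R :=
  n%:R^-1 * \sum_(i < n) `|y i - rkev f (x i)| ^+ 2 + lam * `|f| ^+ 2.

Definition is_minimizer (T : Type) (J : T -> R) (S : set T) (f : T) : Prop :=
  S f /\ forall g, S g -> J f <= J g.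

Lemma sqr_normn n (v : 'I_n -> Y) :
  normn v ^+ 2 = n%:R^-1 * \sum_(i < n) `|v i| ^+ 2.
Proof.
have E : dotn v v = n%:R^-1 * \sum_(i < n) `|v i| ^+ 2.
  by rewrite /dotn; congr (_ * _); apply: eq_bigr => i _; rewrite hdotvv.
rewrite /normn sqr_sqrtr ?E // mulr_ge0 ?invr_ge0 ?ler0n //.
by apply: sumr_ge0 => i _; rewrite exprn_ge0.
Qed.

Lemma dotn_adjn n m (A : 'M[R]_(n, m)) (v : 'I_m -> Y) (w : 'I_n -> Y) :
  dotn (mxact A v) w = \sum_(j < m) hdot Y (v j) (mxact (adjn A) w j).
Proof.
rewrite /dotn /mxact.
under eq_bigr => i _ do rewrite linear_sumlz.
under [RHS]eq_bigr => j _ do rewrite linear_sumr.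
rewrite exchange_big /= mulr_sumr; apply: eq_bigr => j _.
rewrite mulr_sumr; apply: eq_bigr => i _.
by rewrite linearZl_LR !mxE [RHS]linearZr_LR /= mulrA.
Qed.

End Nystrom.

(* Main.v *)
Require Import Defs.
From mathcomp Require Import all_boot all_order all_algebra.
From mathcomp Require Import all_classical all_reals all_analysis.
From mathcomp Require Import ring.
Import Order.TTheory GRing.Theory Num.Theory.
Import numFieldNormedType.Exports.
Local Open Scope classical_set_scope.
Local Open Scope ring_scope.

(** The regularized risk is a quadratic functional. On the span, f is a sum
    [rksec_comb xt b] of kernel sections, and the reproducing property turns
    the differential of the risk at f, in the direction of coefficients c, into
    twice the sum of the inner products of [(A b - adjn Knm y) j] with [c j]
    ([reg_risk_expand]). Hence coefficients that solve the normal equation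
    [A b = adjn Knm y] give a critical point, and the exact second-order
    expansion of the risk around it has as remainder the mean of the
    [`|h (x i)| ^+ 2] plus [lam * `|h| ^+ 2], which is nonnegative and vanishes
    only for h = 0: a critical point is the unique minimizer
    ([normal_equation_minimizer]).

    The kernel being only semidefinite, and sampled points possibly repeated,
    A may be singular. The normal equation is still solvable: A is symmetric,
    and [A c = 0] forces [Knm c = 0] because [c^T A c] is the sum of the
    nonnegative terms [n^-1 |Knm c|^2] and [lam c^T Kmm c]. So the kernel of A
    lies in that of Knm, and, taking orthogonals, the range of [Knm^T] lies in
    that of A ([trmx_factor_gram_add_psd]). This settles existence in all
    cases. When A is invertible, the coefficients [A^-1 (adjn Knm y)] solve the
    normal equation, so they represent the unique minimizer. *)

(** * Solvability of the normal equation *)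

Definition psdmx {R : realType} {m : nat} (S : 'M[R]_m) : Prop :=
  forall c : 'cV[R]_m, 0 <= (c^T *m S *m c) 0 0.

Lemma cV_dot_ge0 {R : realType} {n : nat} (c : 'cV[R]_n) :
  0 <= (c^T *m c) 0 0.
Proof.
by rewrite mxE; apply: sumr_ge0 => i _; rewrite mxE -expr2 sqr_ge0.
Qed.

Lemma cV_dot_eq0 {R : realType} {n : nat} (c : 'cV[R]_n) :
  (c^T *m c) 0 0 = 0 -> c = 0.
Proof.
rewrite mxE => /eqP; rewrite psumr_eq0 => [/allP c0|i _]; last first.
  by rewrite mxE -expr2 sqr_ge0.
apply/matrixP => i j; rewrite ord1 mxE.
by have := c0 i (mem_index_enum i); rewrite mxE /= -expr2 sqrf_eq0 => /eqP.
Qed.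

Lemma ker_gram_add_psd {R : realType} {n m : nat} (w : R) (B : 'M[R]_(n, m))
    (S : 'M[R]_m) (c : 'cV[R]_m) : 0 < w -> psdmx S ->
  (w *: B^T *m B + S) *m c = 0 -> B *m c = 0.
Proof.
move=> w0 Spsd Ac0; apply: cV_dot_eq0.
have : (c^T *m ((w *: B^T *m B + S) *m c)) 0 0 = 0 by rewrite Ac0 mulmx0 mxE.
rewrite mulmxDl mulmxDr -!scalemxAl -scalemxAr trmx_mul !mulmxA mxE.
rewrite [X in X + _]mxE => /eqP; rewrite paddr_eq0 //; last first.
  by apply: mulr_ge0; [exact: ltW|rewrite -mulmxA -trmx_mul cV_dot_ge0].
by rewrite mulf_eq0 gt_eqF //= => /andP[/eqP].
Qed.

(** For symmetric matrices, inclusion of kernels is equivalent to reverse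
    inclusion of ranges; the factor D exhibits the range of [B^T] inside that
    of [w B^T B + S], which need not be invertible. *)
Lemma trmx_factor_gram_add_psd {R : realType} {n m : nat} (w : R)
    (B : 'M[R]_(n, m)) (S : 'M[R]_m) : 0 < w -> S^T = S -> psdmx S ->
  exists D : 'M[R]_(m, n), (w *: B^T *m B + S) *m D = B^T.
Proof.
move=> w0 Ssym Spsd; set A := _ + S.
have Asym : A^T = A.
  by rewrite /A linearD /= trmx_mul linearZ /= trmxK Ssym -scalemxAr scalemxAl.
have /submxP[D BE] : (B <= A)%MS.
  rewrite submxE; apply/eqP/matrixP => i j.
  have /matrixP/(_ i 0) : B *m col j (cokermx A) = 0.
    apply: (ker_gram_add_psd w B S) => //.
    by rewrite -/A colE mulmxA mulmx_coker mul0mx.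
  by rewrite colE mulmxA -colE [LHS]mxE => ->; rewrite !mxE.
by exists D^T; rewrite BE trmx_mul Asym.
Qed.

Lemma gram_psd {R : realType} {X : Type} {k : X -> X -> R} {m : nat}
    (u : 'I_m -> X) : reproducing_kernel k -> psdmx (gram k u u).
Proof.
move=> [_ kpsd] c; rewrite mxE; under eq_bigr do rewrite mxE mulr_suml.
rewrite exchange_big; apply: (le_trans (kpsd m u (fun i => c i 0))).
rewrite le_eqVlt; apply/orP; left; apply/eqP/eq_bigr => i _.
by apply: eq_bigr => j _; rewrite !mxE mulrAC.
Qed.

(** * Real matrices acting on tuples of vectors *)

Lemma mxactM {R : realType} {Y : hilbertType R} {p q r : nat}
    (A : 'M[R]_(p, q)) (B : 'M[R]_(q, r)) (v : 'I_r -> Y) :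
  mxact (A *m B) v = mxact A (mxact B v).
Proof.
apply/funext => i; rewrite /mxact.
under eq_bigr do rewrite mxE scaler_suml.
rewrite exchange_big; apply: eq_bigr => j _.
by rewrite scaler_sumr; apply: eq_bigr => l _; rewrite scalerA.
Qed.

Lemma mxactD {R : realType} {Y : hilbertType R} {p q : nat}
    (A B : 'M[R]_(p, q)) (v : 'I_q -> Y) (i : 'I_p) :
  mxact (A + B) v i = mxact A v i + mxact B v i.
Proof.
by rewrite /mxact -big_split; apply: eq_bigr => j _; rewrite mxE scalerDl.
Qed.

Lemma mxactZ {R : realType} {Y : hilbertType R} {p q : nat}
    (a : R) (A : 'M[R]_(p, q)) (v : 'I_q -> Y) (i : 'I_p) :
  mxact (a *: A) v i = a *: mxact A v i.
Proof.
by rewrite /mxact scaler_sumr; apply: eq_bigr => j _; rewrite mxE scalerA.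
Qed.

Lemma mxact1 {R : realType} {Y : hilbertType R} {p : nat} (v : 'I_p -> Y) :
  mxact 1%:M v = v.
Proof.
apply/funext => i; rewrite /mxact (bigD1 i) //= mxE eqxx scale1r.
by rewrite big1 ?addr0 // => j ji; rewrite mxE eq_sym (negPf ji) scale0r.
Qed.

(** * Hilbert spaces and kernel sections *)

Lemma hdotC {R : realType} {H : hilbertType R} (u v : H) :
  hdot H u v = hdot H v u.
Proof. by rewrite (hermC (hdot H)) expr0 mul1r. Qed.

Lemma sqr_normrD_hdot {R : realType} {H : hilbertType R} (u v : H) :
  `|u + v| ^+ 2 = `|u| ^+ 2 + 2 * hdot H u v + `|v| ^+ 2.
Proof.
rewrite -!hdotvv linearDl !linearDr /= (hdotC v u) mulr_natl mulr2n.
by rewrite !addrA.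
Qed.

Lemma rkevD {R : realType} {X : Type} {Y : hilbertType R} {k : X -> X -> R}
    {G : vvRKHS Y k} (f g : G) (t : X) : rkev (f + g) t = rkev f t + rkev g t.
Proof. by have := rkev_linear 1 f g t; rewrite !scale1r. Qed.

Lemma rkev_sum {R : realType} {X : Type} {Y : hilbertType R} {k : X -> X -> R}
    {G : vvRKHS Y k} (I : finType) (F : I -> G) (t : X) :
  rkev (\sum_i F i) t = \sum_i rkev (F i) t.
Proof.
apply: (big_morph (fun f : G => rkev f t)) => [f g|]; first exact: rkevD.
by apply: (addrI (rkev (0 : G) t)); rewrite -rkevD !addr0.
Qed.

Definition rksec_comb {R : realType} {X : Type} {Y : hilbertType R}
    {k : X -> X -> R} {G : vvRKHS Y k} {m : nat} (xt : 'I_m -> X)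
    (b : 'I_m -> Y) : G := \sum_(j < m) rksec G (xt j) (b j).

(** * The regularized risk on the span of the sampled sections *)

Section NystromMinimizer.
Variables (R : realType) (X : Type) (Y : hilbertType R) (k : X -> X -> R).
Variables (G : vvRKHS Y k) (n m : nat) (x : 'I_n -> X) (xt : 'I_m -> X).
Hypothesis k_sym : forall s t, k s t = k t s.

Lemma rkev_comb (b : 'I_m -> Y) (t : X) :
  rkev (rksec_comb xt b : G) t = \sum_(j < m) k (xt j) t *: b j.
Proof.
by rewrite rkev_sum; apply: eq_bigr => j _; rewrite rkev_sec k_sym.
Qed.

Lemma rkev_comb_gram {p : nat} (u : 'I_p -> X) (b : 'I_m -> Y) :
  (fun i => rkev (rksec_comb xt b : G) (u i)) = mxact (gram k u xt) b.
Proof.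
apply/funext => i; rewrite rkev_comb.
by apply: eq_bigr => j _; rewrite mxE k_sym.
Qed.

Lemma rksec_combD (b c : 'I_m -> Y) :
  rksec_comb xt (fun j => b j + c j)
  = (rksec_comb xt b : G) + rksec_comb xt c.
Proof.
apply: rkev_inj => t; rewrite rkevD !rkev_comb -big_split.
by apply: eq_bigr => j _; rewrite scalerDr.
Qed.

Lemma nystrom_spanE (f : G) :
  nystrom_span xt f <-> exists b, f = rksec_comb xt b.
Proof.
split=> -[b fE]; exists b; last by move=> t; rewrite fE rkev_comb.
by apply: rkev_inj => t; rewrite fE rkev_comb.
Qed.

Lemma hdot_comb (f : G) (c : 'I_m -> Y) :
  hdot G f (rksec_comb xt c) = \sum_(j < m) hdot Y (rkev f (xt j)) (c j).
Proof.
by rewrite linear_sumr; apply: eq_bigr => j _; exact: rk_reproducing.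
Qed.

Variables (y : 'I_n -> Y) (lam : R).
Let Knm := gram k x xt.
Let A := adjn Knm *m Knm + lam *: gram k xt xt.

(** Half the differential of the risk, computed by [dotn_adjn] for the data
    term and by the reproducing property for the penalty. *)
Lemma reg_risk_cross (b c : 'I_m -> Y) :
  let f : G := rksec_comb xt b in
  let h : G := rksec_comb xt c in
  lam * hdot G f h
    - dotn (fun i => y i - rkev f (x i)) (fun i => rkev h (x i))
  = \sum_(j < m) hdot Y (mxact A b j - mxact (adjn Knm) y j) (c j).
Proof.
move=> f h.
have dotC (u v : 'I_n -> Y) : dotn u v = dotn v u.
  by congr (_ * _); apply: eq_bigr => i _; rewrite hdotC.
rewrite dotC rkev_comb_gram dotn_adjn hdot_comb mulr_sumr -sumrB.
apply: eq_bigr => j _.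
have -> : rkev f (xt j) = mxact (gram k xt xt) b j.
  by rewrite -(congr1 (fun F => F j) (rkev_comb_gram xt b)).
have -> : mxact (adjn Knm) (fun i => y i - rkev f (x i)) j
    = mxact (adjn Knm) y j - mxact (adjn Knm *m Knm) b j.
  rewrite mxactM -(rkev_comb_gram x b) /mxact -sumrB.
  by apply: eq_bigr => i _; rewrite scalerBr.
rewrite mxactD mxactZ (hdotC (c j)) !linearBl linearDl (linearZl_LR (hdot Y)) /=.
by rewrite opprB addrCA addrA.
Qed.

Lemma reg_risk_expand (b c : 'I_m -> Y) :
  let f : G := rksec_comb xt b in
  let h : G := rksec_comb xt c in
  reg_risk x y lam (f + h) = reg_risk x y lam f
    + 2 * (\sum_(j < m) hdot Y (mxact A b j - mxact (adjn Knm) y j) (c j))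
    + (normn (fun i => rkev h (x i)) ^+ 2 + lam * `|h| ^+ 2).
Proof.
move=> f h; rewrite -reg_risk_cross -/f -/h sqr_normn /dotn /reg_risk.
rewrite sqr_normrD_hdot.
have -> : \sum_(i < n) `|y i - rkev (f + h) (x i)| ^+ 2
  = \sum_(i < n) `|y i - rkev f (x i)| ^+ 2
    - 2 * (\sum_(i < n) hdot Y (y i - rkev f (x i)) (rkev h (x i)))
    + \sum_(i < n) `|rkev h (x i)| ^+ 2.
  rewrite mulr_sumr -sumrB -[RHS]big_split; apply: eq_bigr => i _ /=.
  rewrite rkevD opprD addrA [LHS]sqr_normrD_hdot normrN.
  by rewrite (linearNr (hdot Y)) mulrN.
ring.
Qed.

Hypothesis lam_gt0 : 0 < lam.

(** At a critical point the first-order term vanishes and the remainder bounds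
    the increase of the risk below by [lam * `|h| ^+ 2]; this gives both
    minimality and uniqueness. *)
Lemma normal_equation_minimizer (b : 'I_m -> Y) :
  mxact A b = mxact (adjn Knm) y ->
  unique (is_minimizer (reg_risk (G := G) x y lam) (nystrom_span xt))
    (rksec_comb xt b).
Proof.
move=> bE; set f : G := rksec_comb xt b.
have fS : nystrom_span xt f by apply/nystrom_spanE; exists b.
have incr g : nystrom_span xt g ->
    reg_risk x y lam f + lam * `|g - f| ^+ 2 <= reg_risk x y lam g.
  move=> /nystrom_spanE[c ->].
  pose d j := c j - b j.
  have cE : rksec_comb xt c = f + rksec_comb xt d :> G.
    rewrite -rksec_combD; congr rksec_comb; apply/funext => j.
    by rewrite /d addrC subrK.
  rewrite cE [X in `|X|]addrC addKr reg_risk_expand bE.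
  rewrite [X in 2 * X]big1 => [|j _]; last by rewrite subrr linear0l.
  by rewrite mulr0 addr0 lerD2l lerDr sqr_ge0.
split=> [|g [gS gmin]].
  split=> // g /incr; apply: le_trans.
  by rewrite lerDl mulr_ge0 ?(ltW lam_gt0) ?exprn_ge0.
have := le_trans (incr g gS) (gmin f fS).
rewrite gerDl pmulr_rle0 // => gf0.
have : `|g - f| ^+ 2 == 0 by rewrite eq_le gf0 exprn_ge0.
by rewrite sqrf_eq0 normr_eq0 subr_eq0 => /eqP.
Qed.

End NystromMinimizer.

Theorem proposition3 (R : realType)
    (X : topologicalType)
    (X_hausdorff : hausdorff_space X)
    (X_lcompact : locally_compact [set: X])
    (X_countable : @second_countable X)
    (Y : hilbertType R)
    (Y_separable : separable Y)
    (k : X -> X -> R)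
    (k_kernel : reproducing_kernel k)
    (G : vvRKHS Y k)
    (n m : nat) (n_gt0 : (0 < n)%N)
    (x : 'I_n -> X) (y : 'I_n -> Y)
    (s : 'I_m -> 'I_n)
    (lam : R) (lam_gt0 : 0 < lam) :
  let xt := fun j : 'I_m => x (s j) in
  let Knm := gram k x xt in
  let Kmm := gram k xt xt in
  let minimizer := is_minimizer (reg_risk (G := G) x y lam)
                                (nystrom_span (G := G) xt) in
  let A := adjn Knm *m Knm + lam *: Kmm in
  (exists! f : G, minimizer f) /\
  (A \in unitmx ->
   forall f : G, minimizer f ->
   let b := mxact (invmx A) (mxact (adjn Knm) y) in
   forall t : X, rkev f t = \sum_(j < m) k (xt j) t *: b j).
Proof.
move=> xt Knm Kmm minimizer A; have [k_sym _] := k_kernel.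
have solve b : mxact A b = mxact (adjn Knm) y ->
    unique minimizer (rksec_comb xt b).
  by apply: normal_equation_minimizer.
split.
  have n1_gt0 : 0 < n%:R^-1 :> R by rewrite invr_gt0 ltr0n.
  have Kmm_sym : (lam *: Kmm)^T = lam *: Kmm.
    by apply/matrixP => i j; rewrite !mxE k_sym.
  have Kmm_psd : psdmx (lam *: Kmm).
    move=> c; rewrite -scalemxAr -scalemxAl mxE.
    by rewrite mulr_ge0 ?(ltW lam_gt0) //; exact: gram_psd.
  have [D DE] := trmx_factor_gram_add_psd _ Knm _ n1_gt0 Kmm_sym Kmm_psd.
  (* The weight 1/n of the adjoint is moved to the solution operator. *)
  exists (rksec_comb xt (mxact (n%:R^-1 *: D) y)); apply: solve.
  by rewrite -mxactM -scalemxAr DE.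
move=> A_unit f fmin b t; rewrite -(rkev_comb _ _ _ _ G _ _ k_sym).
have [_ uniq_b] : unique minimizer (rksec_comb xt b).
  by apply: solve; rewrite /b -mxactM mulmxV // mxact1.
by rewrite (uniq_b f fmin).
Qed.
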